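(* A variety $\mathsf{K}$ of De Morgan monoids consists entirely of Sugihara monoids if and only if neither $\mathbf{C}_4$ nor $\mathbf{D}_4$ belongs to $\mathsf{K}$.
   Context: An involutive (commutative) residuated lattice (IRL) is an algebra $\langle A;\cdot,\wedge,\vee,\neg,e\rangle$ such that $\langle A;\cdot,e\rangle$ is a commutative monoid, $\langle A;\wedge,\vee\rangle$ is a lattice with order $\leqslant$, $\neg\neg x=x$, and $x\cdot y\leqslant z\iff \neg z\cdot y\leqslant\neg x$. Write $f:=\neg e$. A De Morgan monoid is an IRL with distributive lattice reduct satisfying $x\leqslant x\cdot x$. A Sugihara monoid is a De Morgan monoid satisfying $x\cdot x=x$. $\mathbf{C}_4$ is the De Morgan monoid on the chain $0<e<f<1$ with $\neg$ swapping $0,1$ and swapping $e,f$, $e$ neutral for $\cdot$, $0\cdot x=0$ for all $x$, $1\cdot x=1$ for $x\neq 0$, $f\cdot f=1$. $\mathbf{D}_4$ is the De Morgan monoid on the lattice with least element $0$, greatest element $1$, and $e,f$ incomparable, with $\neg$ swapping $0,1$ and swapping $e,f$, $e$ neutral, $0\cdot x=0$ for all $x$, $1\cdot x=1$ for $x\neq0$, $f\cdot f=1$. Membership is up to isomorphism. *)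

(* Defs.v *)
From mathcomp Require Import all_boot.

Set Implicit Arguments.
Unset Strict Implicit.
Unset Printing Implicit Defensive.

(* Algebras of signature <fusion, meet, join, neg, e>, with no axioms imposed.
   MathComp's order structures are not used because they carry the order and a
   choice operator as extra data, whereas homomorphism-invariant notions such as
   "variety" refer to exactly this signature and to arbitrary carriers. *)
Record algebra := Algebra {
  carrier :> Type;
  fusion : carrier -> carrier -> carrier;
  meet : carrier -> carrier -> carrier;
  join : carrier -> carrier -> carrier;
  neg : carrier -> carrier;
  neut : carrier }.

Arguments neut : clear implicits.

Definition ale (A : algebra) (x y : A) : Prop := meet x y = x.

(* Idempotence of meet and join follows from the absorption laws. *)
Record is_lattice (A : algebra) : Prop := IsLattice {
  meet_assoc : associative (@meet A);
  meet_comm : commutative (@meet A);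
  join_assoc : associative (@join A);
  join_comm : commutative (@join A);
  meet_absorb : forall x y : A, meet x (join x y) = x;
  join_absorb : forall x y : A, join x (meet x y) = x }.

Record is_irl (A : algebra) : Prop := IsIRL {
  irl_lattice : is_lattice A;
  fusion_assoc : associative (@fusion A);
  fusion_comm : commutative (@fusion A);
  fusion_neut : left_id (neut A) (@fusion A);
  neg_invol : involutive (@neg A);
  residuation : forall x y z : A,
    ale (fusion x y) z <-> ale (fusion (neg z) y) (neg x) }.

Record is_de_morgan_monoid (A : algebra) : Prop := IsDeMorganMonoid {
  dmm_irl : is_irl A;
  dmm_distr : left_distributive (@meet A) (@join A);
  square_increasing : forall x : A, ale x (fusion x x) }.

Record is_sugihara_monoid (A : algebra) : Prop := IsSugiharaMonoid {
  sugihara_dmm : is_de_morgan_monoid A;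
  fusion_idem : forall x : A, fusion x x = x }.

Inductive term : Type :=
  | TVar of nat
  | TFusion of term & term
  | TMeet of term & term
  | TJoin of term & term
  | TNeg of term
  | TNeut.

Fixpoint eval (A : algebra) (v : nat -> A) (t : term) : A :=
  match t with
  | TVar n => v n
  | TFusion s t => fusion (eval v s) (eval v t)
  | TMeet s t => meet (eval v s) (eval v t)
  | TJoin s t => join (eval v s) (eval v t)
  | TNeg s => neg (eval v s)
  | TNeut => neut A
  end.

(* [E] is a set of equations, given as a set of pairs of terms. *)
Definition satisfies (A : algebra) (E : term -> term -> Prop) : Prop :=
  forall s t, E s t -> forall v : nat -> A, eval v s = eval v t.

(* A variety is an equationally definable class; in particular it is closed
   under isomorphism. *)
Definition is_variety (K : algebra -> Prop) : Prop :=
  exists E : term -> term -> Prop, forall A : algebra, K A <-> satisfies A E.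

(* Common universe {0, e, f, 1} of C4 and D4, which also share their monoid
   operation and their negation. *)
Inductive four : Set := Zero4 | E4 | F4 | One4.

Definition mul4 (x y : four) : four :=
  match x, y with
  | Zero4, _ | _, Zero4 => Zero4
  | E4, z | z, E4 => z
  | _, _ => One4
  end.

Definition neg4 (x : four) : four :=
  match x with Zero4 => One4 | E4 => F4 | F4 => E4 | One4 => Zero4 end.

(* Chain 0 < e < f < 1. *)
Definition C4_meet (x y : four) : four :=
  match x, y with
  | Zero4, _ | _, Zero4 => Zero4
  | E4, _ | _, E4 => E4
  | F4, _ | _, F4 => F4
  | One4, One4 => One4
  end.

Definition C4_join (x y : four) : four :=
  match x, y with
  | One4, _ | _, One4 => One4
  | F4, _ | _, F4 => F4
  | E4, _ | _, E4 => E4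
  | Zero4, Zero4 => Zero4
  end.

(* Diamond with bottom 0, top 1 and atoms e, f. *)
Definition D4_meet (x y : four) : four :=
  match x, y with
  | One4, z | z, One4 => z
  | E4, E4 => E4
  | F4, F4 => F4
  | _, _ => Zero4
  end.

Definition D4_join (x y : four) : four :=
  match x, y with
  | Zero4, z | z, Zero4 => z
  | E4, E4 => E4
  | F4, F4 => F4
  | _, _ => One4
  end.

Definition C4 : algebra := Algebra mul4 C4_meet C4_join neg4 E4.

Definition D4 : algebra := Algebra mul4 D4_meet D4_join neg4 E4.

(* Main.v *)
Require Import Defs.
From mathcomp Require Import all_boot.
From Stdlib Require Import Classical.

(** In a De Morgan monoid [f * f <= f] already forces idempotence, so a
    non-Sugihara algebra [A] has [w := f * f] with [w <= f] false. An element
    [c <= e] is idempotent, and [c * x <= y] is the order of the quotient of [A]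
    by the filter generated by [c]; this quotient is trivial on constants only
    when [c <= neg w]. If [e /\ f <= neg w] fails, then modulo [c := e /\ f] the
    constants [neg w, e, f, w] form a chain, a copy of C4. Otherwise, modulo
    [c := e /\ w], the elements [e] and [f] meet in the bottom [neg w], and the
    constants form a copy of D4. *)

Set Implicit Arguments.
Unset Strict Implicit.
Unset Printing Implicit Defensive.

Declare Scope irl_scope.
Local Open Scope irl_scope.
Local Infix "*" := fusion : irl_scope.
Local Infix "<=" := ale : irl_scope.

Section DeMorganMonoid.
Variables (A : algebra) (hA : is_de_morgan_monoid A).
Implicit Types x y z : A.
Let hI := dmm_irl hA.
Let hL := irl_lattice hI.
Local Notation e := (neut A).
Local Notation f := (neg e).

(** * Order, negation and fusion in a De Morgan monoid *)

Lemma ale_refl x : x <= x.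
Proof. by rewrite /ale -{2}(join_absorb hL x x) meet_absorb. Qed.

Lemma ale_trans y x z : x <= y -> y <= z -> x <= z.
Proof. by rewrite /ale => <- <-; rewrite (meet_assoc hL) -!(meet_assoc hL) ale_refl. Qed.

Lemma ale_anti x y : x <= y -> y <= x -> x = y.
Proof. by rewrite /ale => xy yx; rewrite -xy (meet_comm hL). Qed.

Lemma meet_lel x y : meet x y <= x.
Proof. by rewrite /ale (meet_comm hL) (meet_assoc hL) ale_refl. Qed.

Lemma meet_ler x y : meet x y <= y.
Proof. by rewrite /ale -(meet_assoc hL) ale_refl. Qed.

Lemma le_meet x y z : z <= x -> z <= y -> z <= meet x y.
Proof. by rewrite /ale => zx zy; rewrite (meet_assoc hL) zx zy. Qed.

Lemma le_joinl x y : x <= join x y.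
Proof. exact: meet_absorb. Qed.

Lemma le_joinr x y : y <= join x y.
Proof. by rewrite (join_comm hL); exact: le_joinl. Qed.

Lemma join_le x y z : x <= z -> y <= z -> join x y <= z.
Proof. by rewrite /ale (dmm_distr hA) => -> ->. Qed.

Lemma neg_le x y : x <= y <-> neg y <= neg x.
Proof.
have := residuation hI x e y.
by rewrite !(fusion_comm hI _ e) !(fusion_neut hI).
Qed.

Lemma neg_join x y : join x y = neg (meet (neg x) (neg y)).
Proof.
apply: ale_anti.
  by apply: join_le; apply/neg_le; rewrite (neg_invol hI);
     [exact: meet_lel | exact: meet_ler].
apply/neg_le; rewrite (neg_invol hI).
by apply: le_meet; apply/neg_le; rewrite !(neg_invol hI);
   [exact: le_joinl | exact: le_joinr].
Qed.

Lemma fusion_e x : x * e = x.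
Proof. by rewrite (fusion_comm hI) (fusion_neut hI). Qed.

(** Residuating [y * z <= y * z] gives [neg (y * z) * z <= neg y]; since [neg y <= neg x], one can
    residuate back. *)
Lemma fusion_lel x y z : x <= y -> x * z <= y * z.
Proof.
move=> xy; apply/(residuation hI).
apply: ale_trans _ (proj1 (neg_le _ _) xy).
exact: proj1 (residuation hI _ _ _) (ale_refl _).
Qed.

Lemma fusion_ler x y z : x <= y -> z * x <= z * y.
Proof. by rewrite !(fusion_comm hI z); exact: fusion_lel. Qed.

Lemma fusion_le x y x' y' : x <= x' -> y <= y' -> x * y <= x' * y'.
Proof. by move=> /fusion_lel xx' yy'; apply: ale_trans (xx' y) (fusion_ler _ yy'). Qed.

(** [f] is a dualizing element: a bound by a negation becomes a bound of a product by [f], whose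
    factors can then be regrouped. *)
Lemma fusion_f x y : x * y <= f <-> x <= neg y.
Proof.
rewrite (residuation hI) (neg_invol hI) (fusion_neut hI) (neg_le x).
by rewrite (neg_invol hI).
Qed.

Lemma fusion_neg x : x * neg x <= f.
Proof. by apply/fusion_f; rewrite (neg_invol hI); exact: ale_refl. Qed.

(** The meet lies below its own square, which monotonicity bounds by [x * neg x]. *)
Lemma meet_neg x : meet x (neg x) <= f.
Proof.
apply: ale_trans (square_increasing hA _) _; apply: ale_trans (fusion_neg x).
by apply: fusion_le; [exact: meet_lel | exact: meet_ler].
Qed.

Lemma e_le_join_neg x : e <= join x (neg x).
Proof.
rewrite neg_join (neg_invol hI) (meet_comm hL).
by apply/fusion_f; rewrite (fusion_neut hI); exact: meet_neg.
Qed.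

Lemma ff_le_f : f * f <= f <-> f <= e.
Proof. by rewrite (residuation hI) (neg_invol hI) (fusion_neut hI). Qed.

(* [a := x * neg x] satisfies [a <= f <= e], so [a <= a * neg x <= neg x]. *)
Lemma sugihara_of_f_le_e : f <= e -> is_sugihara_monoid A.
Proof.
move=> fe; split=> // x; apply: ale_anti; last exact: square_increasing.
apply/(residuation hI); rewrite (fusion_comm hI).
apply: (@ale_trans (x * neg x * neg x)).
  by rewrite -(fusion_assoc hI); apply: fusion_ler; exact: square_increasing.
rewrite -{3}(fusion_neut hI (neg x)); apply: fusion_lel.
exact: ale_trans (fusion_neg x) fe.
Qed.

(** By distributivity [e] is the join of [meet e x] and [meet e (neg x)]; both lie below [neg x],
    hence so does [e]. *)
Lemma e_meet_le_neg x : meet e x <= neg x -> x <= f.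
Proof.
move=> ex; apply/neg_le; rewrite (neg_invol hI).
have -> : e = meet e (join x (neg x)) by rewrite e_le_join_neg.
rewrite (meet_comm hL) (dmm_distr hA) !(meet_comm hL _ e).
by apply: join_le; [exact: ex | exact: meet_ler].
Qed.

Lemma f_le_ff : f <= f * f.
Proof. exact: square_increasing. Qed.

(* With [a := neg (f * f)], the residual of [e] by [f], this is
   [a * f * f <= (a * f) * (a * f) <= e]. *)
Lemma fff_le : f * f * f <= f * f.
Proof.
set a := neg (f * f).
have fae : f * a <= e.
  rewrite -[X in _ <= X](neg_invol hI); apply/fusion_f.
  rewrite -(fusion_assoc hI) (fusion_comm hI a) (fusion_assoc hI).
  exact: fusion_neg.
have ffae : f * f * a <= e.
  apply: (@ale_trans (f * f * (a * a))).
    by apply: fusion_ler; exact: square_increasing.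
  rewrite -(fusion_assoc hI) (fusion_assoc hI f a) (fusion_comm hI _ a).
  rewrite (fusion_assoc hI) -[X in _ <= X]fusion_e.
  exact: fusion_le.
rewrite -[X in _ <= X](neg_invol hI); apply/fusion_f.
rewrite -!(fusion_assoc hI) (fusion_assoc hI f f a) -[X in _ <= X]fusion_e.
exact: fusion_ler.
Qed.

Lemma ffff_le : f * f * (f * f) <= f * f.
Proof.
rewrite (fusion_assoc hI); apply: ale_trans fff_le.
exact: fusion_lel fff_le.
Qed.

(** * The order modulo an element below [e] *)

Section Quotient.
Variables (c : A) (hc : c <= e).

Lemma below_e_idem : c * c = c.
Proof.
apply: ale_anti; last exact: square_increasing.
by rewrite -{3}(fusion_e c); exact: fusion_ler.
Qed.

Definition lec x y := c * x <= y.
Definition eqc x y := lec x y /\ lec y x.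

Lemma lec_ale x y : x <= y -> lec x y.
Proof.
by move=> xy; apply: ale_trans xy; rewrite -{2}(fusion_neut hI x); exact: fusion_lel.
Qed.

Lemma lec_refl x : lec x x.
Proof. exact/lec_ale/ale_refl. Qed.

Lemma lec_trans y x z : lec x y -> lec y z -> lec x z.
Proof.
rewrite /lec => xy; apply: ale_trans.
by rewrite -{1}below_e_idem -(fusion_assoc hI); exact: fusion_ler.
Qed.

(** Idempotence of [c] supplies one copy of [c] for each factor. *)
Lemma lec_fusion x y x' y' : lec x x' -> lec y y' -> lec (x * y) (x' * y').
Proof.
rewrite /lec => xx' yy'; rewrite -below_e_idem -(fusion_assoc hI).
rewrite (fusion_assoc hI c x) (fusion_comm hI (c * x)) (fusion_assoc hI).
by rewrite (fusion_comm hI); exact: fusion_le.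
Qed.

(** By [fusion_f] both inequalities say [c * x * neg y <= f]. *)
Lemma lec_neg x y : lec x y -> lec (neg y) (neg x).
Proof.
rewrite /lec -{1}(neg_invol hI y) => /fusion_f xy; apply/fusion_f.
by rewrite -(fusion_assoc hI) (fusion_comm hI (neg y)) (fusion_assoc hI).
Qed.

Lemma lec_meet x y z : lec z x -> lec z y -> lec z (meet x y).
Proof. exact: le_meet. Qed.

Lemma lec_meet_mono x y x' y' :
  lec x x' -> lec y y' -> lec (meet x y) (meet x' y').
Proof.
move=> xx' yy'; apply: lec_meet.
  by apply: lec_trans xx'; apply: lec_ale; exact: meet_lel.
by apply: lec_trans yy'; apply: lec_ale; exact: meet_ler.
Qed.

Lemma eqc_refl x : eqc x x.
Proof. by split; exact: lec_refl. Qed.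

Lemma eqc_sym x y : eqc x y -> eqc y x.
Proof. by case. Qed.

Lemma eqc_trans y x z : eqc x y -> eqc y z -> eqc x z.
Proof. by case=> xy yx [yz zy]; split; apply: (@lec_trans y). Qed.

(** * Transfer of equations to an algebra embedded in the quotient *)

Section Transfer.
Variables (B : algebra) (k : B -> A).
Hypothesis k_fusion : forall i j, eqc (k (i * j)) (k i * k j).
Hypothesis k_meet : forall i j, eqc (k (meet i j)) (meet (k i) (k j)).
Hypothesis k_neg : forall i, k (neg i) = neg (k i).
Hypothesis k_neut : k (neut B) = e.
Hypothesis k_inj : forall i j, eqc (k i) (k j) -> i = j.
Hypothesis B_join : forall i j : B, join i j = neg (meet (neg i) (neg j)).

Lemma eval_eqc (v : nat -> B) t : eqc (k (eval v t)) (eval (k \o v) t).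
Proof.
have eqc_neg x y : eqc x y -> eqc (neg x) (neg y) by case; split; exact: lec_neg.
have eqc_meet x y x' y' : eqc x x' -> eqc y y' -> eqc (meet x y) (meet x' y').
  by case=> ? ? [? ?]; split; exact: lec_meet_mono.
elim: t => [n|s [s1 s2] t [t1 t2]|s IHs t IHt|s IHs t IHt|s IHs|] /=.
- exact: eqc_refl.
- by apply: eqc_trans (k_fusion _ _) _; split; exact: lec_fusion.
- by apply: eqc_trans (k_meet _ _) (eqc_meet _ _ _ _ IHs IHt).
(* Joins on both sides are rewritten through meets and negations, which [k] respects modulo [c]. *)
- rewrite B_join k_neg neg_join; apply: (eqc_neg).
  apply: eqc_trans (k_meet _ _) _; rewrite !k_neg.
  by apply: eqc_meet; exact: eqc_neg.
- by rewrite k_neg; exact: eqc_neg.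
- by rewrite k_neut; exact: eqc_refl.
Qed.

(** [k] embeds [B] in the quotient of [A] by [eqc], a quotient that is never formed: both sides of
    an equation get equal values in [A], and [k_inj] pulls this back. *)
Lemma satisfies_transfer E : satisfies A E -> satisfies B E.
Proof.
move=> AE s t st v; apply: k_inj.
apply: eqc_trans (eval_eqc v s) _; rewrite (AE _ _ st).
exact/eqc_sym/eval_eqc.
Qed.
End Transfer.

(** * The four constants modulo [c] *)

Section Constants.
Hypothesis (c_ff : c <= f * f) (c_neg : ~ c <= neg (f * f)).

Definition const4 (i : four) : A :=
  match i with Zero4 => neg (f * f) | E4 => e | F4 => f | One4 => f * f end.

Lemma lec_e_ff : lec e (f * f).
Proof. by rewrite /lec fusion_e. Qed.

Lemma lec_0_f : lec (neg (f * f)) f.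
Proof. exact: lec_neg lec_e_ff. Qed.

Lemma le_0_e : neg (f * f) <= e.
Proof. by apply/neg_le; rewrite (neg_invol hI); exact: f_le_ff. Qed.

Lemma lec_0 i : lec (const4 Zero4) (const4 i).
Proof.
case: i => /=; [exact: lec_refl | exact: lec_ale le_0_e | exact: lec_0_f |].
exact: lec_trans lec_0_f (lec_ale f_le_ff).
Qed.

Lemma const4_neg i : const4 (neg4 i) = neg (const4 i).
Proof. by case: i; rewrite //= (neg_invol hI). Qed.

Lemma lec_1 i : lec (const4 i) (const4 One4).
Proof. by move: (lec_neg (lec_0 (neg4 i))); rewrite const4_neg /= !(neg_invol hI). Qed.

(** Two uses of [fusion_f] turn [c * f <= e] into [c <= neg (f * f)]. *)
Lemma not_lec_f_e : ~ lec f e.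
Proof.
rewrite /lec -[X in _ <= X](neg_invol hI) => /fusion_f; rewrite -(fusion_assoc hI).
by move=> /fusion_f.
Qed.

(** Modulo [c] the product lies between the square of [neg (f * f)], which is above [neg (f * f)],
    and [neg (f * f) * (f * f)], which is below it by [ffff_le]. *)
Lemma const4_0_mul i : eqc (neg (f * f)) (neg (f * f) * const4 i).
Proof.
split.
  apply: lec_trans (lec_ale (square_increasing hA _)) _.
  exact: lec_fusion (lec_refl _) (lec_0 i).
apply: (@lec_trans (neg (f * f) * (f * f))).
  exact: lec_fusion (lec_refl _) (lec_1 i).
apply/lec_ale/fusion_f; rewrite -(fusion_assoc hI) (fusion_comm hI).
by apply/fusion_f; rewrite (neg_invol hI); exact: ffff_le.
Qed.

Lemma const4_fusion i j : eqc (const4 (mul4 i j)) (const4 i * const4 j).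
Proof.
have comm x y z : eqc z (y * x) -> eqc z (x * y) by rewrite (fusion_comm hI).
have fff : eqc (f * f) (f * f * f).
  split; apply: lec_ale; last exact: fff_le.
  by apply: fusion_lel; exact: f_le_ff.
case: i; case: j => /=; try exact: (const4_0_mul Zero4);
  try exact: (const4_0_mul E4); try exact: (const4_0_mul F4);
  try exact: (const4_0_mul One4); rewrite ?fusion_e ?(fusion_neut hI);
  try exact: eqc_refl; try exact: fff.
- exact/comm/(const4_0_mul F4).
- exact/comm/fff.
- exact/comm/(const4_0_mul One4).
- by split; apply: lec_ale; [exact: square_increasing | exact: ffff_le].
Qed.

(** Each of the six pairs of distinct constants is separated by one failing inequality, refuted by
    [c_neg] directly or through [not_lec_f_e]. *)
Lemma const4_inj i j : eqc (const4 i) (const4 j) -> i = j.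
Proof.
have ne : ~ lec e (neg (f * f)) by rewrite /lec fusion_e.
have nf : ~ lec f (neg (f * f)).
  by move=> h; apply: not_lec_f_e; apply: lec_trans h (lec_ale le_0_e).
have n1 : ~ lec (f * f) (neg (f * f)).
  by move=> h; apply: nf; apply: lec_trans (lec_ale f_le_ff) h.
have n1e : ~ lec (f * f) e.
  by move=> h; apply: not_lec_f_e; apply: lec_trans (lec_ale f_le_ff) h.
have n1f : ~ lec (f * f) f.
  by move=> h; apply: ne; have := lec_neg h; rewrite (neg_invol hI).
by case: i; case: j => //= -[h1 h2]; first
  [case: (ne h1)|case: (ne h2)|case: (nf h1)|case: (nf h2)|case: (n1 h1)
  |case: (n1 h2)|case: (n1e h1)|case: (n1e h2)|case: (n1f h1)|case: (n1f h2)
  |case: (not_lec_f_e h1)|case: (not_lec_f_e h2)].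
Qed.

Lemma eqc_meetl x y : lec x y -> eqc x (meet x y).
Proof.
move=> xy; split; first exact: lec_meet (lec_refl x) xy.
by apply: lec_ale; exact: meet_lel.
Qed.

Lemma eqc_meetr x y : lec y x -> eqc y (meet x y).
Proof. by rewrite (meet_comm hL); exact: eqc_meetl. Qed.

(** As [c * e = c], the bound [c <= f] puts [e] below [f] modulo [c], so the constants form a
    chain. *)
Lemma satisfies_C4 E : c <= f -> satisfies A E -> satisfies C4 E.
Proof.
move=> cf; apply: (@satisfies_transfer C4 const4) => //.
- exact: const4_fusion.
- have ef : lec e f by rewrite /lec fusion_e.
  case=> -[]; first [exact: eqc_meetl (lec_refl _)
    | exact: eqc_meetl (lec_0 _) | exact: eqc_meetr (lec_0 _)
    | exact: eqc_meetl (lec_1 _) | exact: eqc_meetr (lec_1 _)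
    | exact: eqc_meetl | exact: eqc_meetr].
- exact: const4_neg.
- exact: const4_inj.
- by case=> -[].
Qed.

(** Modulo [c], [neg (f * f)] is below both [e] and [f]; the hypothesis makes it their meet. *)
Lemma satisfies_D4 E : meet e f <= neg (f * f) -> satisfies A E -> satisfies D4 E.
Proof.
move=> ef0; apply: (@satisfies_transfer D4 const4) => //.
- exact: const4_fusion.
- have ef : eqc (neg (f * f)) (meet e f).
    by split; [exact: lec_meet (lec_0 E4) (lec_0 F4) | exact: lec_ale].
  case=> -[]; first [exact: eqc_meetl (lec_refl _)
    | exact: eqc_meetl (lec_0 _) | exact: eqc_meetr (lec_0 _)
    | exact: eqc_meetl (lec_1 _) | exact: eqc_meetr (lec_1 _)
    | exact: ef | by rewrite (meet_comm hL)].
- exact: const4_neg.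
- exact: const4_inj.
- by case=> -[].
Qed.

End Constants.
End Quotient.

(** * Choice of [c] and conclusion *)

Lemma satisfies_C4_or_D4 E :
  satisfies A E -> ~ is_sugihara_monoid A -> satisfies C4 E \/ satisfies D4 E.
Proof.
move=> AE nS.
case: (classic (meet e f <= neg (f * f))) => ef0; [right | left].
  apply: (@satisfies_D4 (meet e (f * f))) => //.
  - exact: meet_lel.
  - exact: meet_ler.
  (* A collapse of the constants would give [f * f <= f], making [A] Sugihara. *)
  - by move=> /e_meet_le_neg /ff_le_f /sugihara_of_f_le_e.
(* Here [c_neg] is the case assumption [ef0] itself. *)
apply: (@satisfies_C4 (meet e f)) => //.
- exact: meet_lel.
- exact: ale_trans (meet_ler _ _) f_le_ff.
- exact: meet_ler.
Qed.

End DeMorganMonoid.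

Theorem theorem5p21 (K : algebra -> Prop)
    (K_variety : is_variety K)
    (K_dmm : forall A : algebra, K A -> is_de_morgan_monoid A) :
  (forall A : algebra, K A -> is_sugihara_monoid A) <-> (~ K C4 /\ ~ K D4).
Proof.
split=> [KS | [nC nD] A KA].
  (* In both algebras [F4] squares to [One4]. *)
  by split=> /KS /fusion_idem /(_ F4).
apply: NNPP => nS; case: K_variety => E KE.
have AE : satisfies A E by apply/KE.
by case: (satisfies_C4_or_D4 (K_dmm A KA) AE nS) => /KE.
Qed.
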